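(* Suppose the loss function $\ell(\boldsymbol x,\boldsymbol\xi)=\max_{j\in[m]}\boldsymbol a_j(\boldsymbol x)^\top\boldsymbol\xi+b_j$ is piecewise linear convex in $\boldsymbol x$ and the feasible set $\mathcal X$ is second-order conic representable. Let $\overline w_i=\mathcal K\big(\frac{\boldsymbol\gamma-\boldsymbol\gamma^i}{h}\big)/\sum_{j=1}^n\mathcal K\big(\frac{\boldsymbol\gamma-\boldsymbol\gamma^j}{h}\big)$ denote the kernel weight associated with the $i$-th observation. Then the regularized problem $$\min_{\boldsymbol x\in\mathcal X}\ \hat{\mathbb E}_{\boldsymbol\gamma}[\ell(\boldsymbol x,\tilde{\boldsymbol\xi})]+\lambda\sqrt{\hat{\mathbb V}_{\boldsymbol\gamma}[\ell(\boldsymbol x,\tilde{\boldsymbol\xi})]}$$ is solvable as the following mixed-integer second-order cone program: $$\begin{array}{cll} \min & \overline{\boldsymbol w}^\top\boldsymbol\nu+\lambda\rho\\ \text{s.t.} & \big(\sqrt{\overline w_1}(\nu_1-t),\ldots,\sqrt{\overline w_n}(\nu_n-t),\rho\big)\in\mathcal{SOC}(n+1),\\ & \boldsymbol a_j(\boldsymbol x)^\top\boldsymbol\xi^i+b_j\le\nu_i & \forall i\in[n]\ \forall j\in[m],\\ & \boldsymbol a_j(\boldsymbol x)^\top\boldsymbol\xi^i+b_j+M(1-z_{ij})\ge\nu_i & \forall i\in[n]\ \forall j\in[m],\\ & \sum_{j\in[m]}z_{ij}=1 & \forall i\in[n],\\ & \boldsymbol x\in\mathcal X,\ \boldsymbol\nu\in\mathbb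 R^n,\ \rho\in\mathbb R,\ t\in\mathbb R,\ \boldsymbol z\in\{0,1\}^{n\times m}, \end{array}$$ where $M>0$ is a sufficiently large constant. Under the assumption that $\ell(\boldsymbol x,\boldsymbol\xi)$ takes values in the interval $[0,1]$, it is sufficient to set $M=1$.
   Context: Data $(\boldsymbol\gamma^i,\boldsymbol\xi^i)\in\mathbb R^p\times\mathbb R^q$, $i\in[n]=\{1,\dots,n\}$, a fixed $\boldsymbol\gamma\in\mathbb R^p$, a bandwidth $h>0$ and a regularization parameter $\lambda\ge0$ are given; $\mathcal X\subseteq\mathbb R^d$ is the feasible set. The kernel is $\mathcal K(\boldsymbol\theta)=\frac1Z\exp(-\|\boldsymbol\theta\|_2)$ with $Z=\int_{\mathbb R^p}\exp(-\|\boldsymbol\theta\|_2)\,d\boldsymbol\theta$. The Nadaraya-Watson estimator is $\hat{\mathbb E}_{\boldsymbol\gamma}[\ell(\boldsymbol x,\tilde{\boldsymbol\xi})]=\sum_{i=1}^n\overline w_i\,\ell(\boldsymbol x,\boldsymbol\xi^i)$, and the empirical conditional variance is $\hat{\mathbb V}_{\boldsymbol\gamma}[\ell(\boldsymbol x,\tilde{\boldsymbol\xi})]=\sum_{i=1}^n\overline w_i\big(\ell(\boldsymbol x,\boldsymbol\xi^i)-\hat{\mathbb E}_{\boldsymbol\gamma}[\ell(\boldsymbol x,\tilde{\boldsymbol\xi})]\big)^2$. The second-order cone $\mathcal{SOC}(n+1)\subseteq\mathbb R^{n+1}$ is defined by $\boldsymbol v\in\mathcal{SOC}(n+1)\iff\|(v_1,\dots,v_n)^\top\|\le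 v_{n+1}$. ''Solvable as'' means equivalence of the two optimization problems (in the sense of a reformulation, with $\boldsymbol x$ the common decision).
   Formalization: For M=1, the pieces a_j(x)^T ξ^i+b_j are also assumed nonnegative on X (false otherwise: constant pieces 1/2 and -5). A sufficiently large M is claimed when the minimum is attained, X is bounded, or M bounds all gaps between loss and pieces; for an unattained infimum it can fail. *)

(* Defs.v *)
From HB Require Import structures.
From mathcomp Require Import all_boot all_order all_algebra.
From mathcomp Require Import all_classical all_reals all_analysis.

Set Implicit Arguments.
Unset Strict Implicit.
Unset Printing Implicit Defensive.

Import Order.TTheory GRing.Theory Num.Theory.
Import numFieldNormedType.Exports.

Local Open Scope classical_set_scope.
Local Open Scope ring_scope.

(* The norm [`|v|] that the library puts on matrices is the sup norm. *)
Definition l2norm (R : realType) (k : nat) (v : 'cV[R]_k) : R :=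
  Num.sqrt (\sum_(i < k) v i 0 ^+ 2).

Definition dot (R : realType) (k : nat) (u v : 'cV[R]_k) : R := (u^T *m v) 0 0.

(* The library has no Lebesgue measure on R^p; by Tonelli's theorem the integral
   over R^p of a nonnegative measurable function is the iterated integral. *)
Fixpoint integral_cV (R : realType) (p : nat) : ('cV[R]_p -> \bar R) -> \bar R :=
  if p is p'.+1 return ('cV[R]_p -> \bar R) -> \bar R then
    fun f => (\int[@lebesgue_measure R]_(s in setT)
                integral_cV (fun u : 'cV[R]_p' => f (col_mx (s%:M : 'cV[R]_1) u)))%E
  else fun f => f 0.

Definition kernel_Z (R : realType) (p : nat) : R :=
  fine (integral_cV (fun theta : 'cV[R]_p => (expR (- l2norm theta))%:E)).

Definition exp_kernel (R : realType) (p : nat) (theta : 'cV[R]_p) : R :=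
  (kernel_Z R p)^-1 * expR (- l2norm theta).

Definition kernel_weight (R : realType) (p n : nat) (gam : 'I_n -> 'cV[R]_p)
    (gamma : 'cV[R]_p) (h : R) (i : 'I_n) : R :=
  exp_kernel (h^-1 *: (gamma - gam i)) /
  \sum_(j < n) exp_kernel (h^-1 *: (gamma - gam j)).

Definition NW_expectation (R : realType) (q n : nat) (w : 'I_n -> R)
    (xi : 'I_n -> 'cV[R]_q) (f : 'cV[R]_q -> R) : R :=
  \sum_(i < n) w i * f (xi i).

Definition NW_variance (R : realType) (q n : nat) (w : 'I_n -> R)
    (xi : 'I_n -> 'cV[R]_q) (f : 'cV[R]_q -> R) : R :=
  \sum_(i < n) w i * (f (xi i) - NW_expectation w xi f) ^+ 2.

Definition piece (R : realType) (d q m : nat) (a : 'I_m -> 'cV[R]_d -> 'cV[R]_q)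
    (b : 'I_m -> R) (x : 'cV[R]_d) (xi : 'cV[R]_q) (j : 'I_m) : R :=
  dot (a j x) xi + b j.

(* [R] has no least element, so the maximum is started at the first piece. *)
Definition loss (R : realType) (d q m : nat) (m_gt0 : (0 < m)%N)
    (a : 'I_m -> 'cV[R]_d -> 'cV[R]_q) (b : 'I_m -> R)
    (x : 'cV[R]_d) (xi : 'cV[R]_q) : R :=
  \big[Num.max/piece a b x xi (Ordinal m_gt0)]_(j < m) piece a b x xi j.

Definition regularized_objective (R : realType) (d q m n : nat)
    (m_gt0 : (0 < m)%N) (a : 'I_m -> 'cV[R]_d -> 'cV[R]_q) (b : 'I_m -> R)
    (w : 'I_n -> R) (xi : 'I_n -> 'cV[R]_q) (lambda : R) (x : 'cV[R]_d) : R :=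
  NW_expectation w xi (loss m_gt0 a b x) +
  lambda * Num.sqrt (NW_variance w xi (loss m_gt0 a b x)).

Definition affine_map (R : realType) (V W : lmodType R) (f : V -> W) : Prop :=
  exists (L : {linear V -> W}) (c : W), forall v, f v = L v + c.

Definition SOC (R : realType) (k : nat) : set 'cV[R]_(k + 1) :=
  [set v | l2norm (usubmx v) <= dsubmx v 0 0].
Arguments SOC {R} k.

(* Projection of the solution set of finitely many conic constraints, affine in
   the original variables [v] and in auxiliary variables [u]. *)
Definition SOC_representable (R : realType) (V : lmodType R) (S : set V) : Prop :=
  exists (k N : nat) (s : 'I_N -> nat)
         (f : forall l : 'I_N, (V * 'cV[R]_k)%type -> 'cV[R]_(s l + 1)),
    (forall l, affine_map (f l)) /\
    S = [set v | exists u : 'cV[R]_k, forall l, SOC (s l) (f l (v, u))].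

Definition binary_mx (R : realType) (k l : nat) (z : 'M[R]_(k, l)) : Prop :=
  forall i j, z i j = 0 \/ z i j = 1.

(* The problem of minimizing [g] over [F] is a mixed-integer second-order cone
   program: [C] holds the continuous variables, the matrix the binary ones. *)
Definition mixed_integer_SOCP (R : realType) (C : lmodType R) (k l : nat)
    (F : set (C * 'M[R]_(k, l))) (g : C * 'M[R]_(k, l) -> R) : Prop :=
  affine_map (g : C * 'M[R]_(k, l) -> R^o) /\
  exists S : set (C * 'M[R]_(k, l)),
    SOC_representable S /\ F = S `&` [set y | binary_mx y.2].

Definition is_minimizer (R : realType) (T : Type) (X : set T) (f : T -> R)
    (x : T) : Prop :=
  X x /\ forall x', X x' -> f x <= f x'.

Definition optimal_value (R : realType) (T : Type) (X : set T) (f : T -> R) :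
    \bar R :=
  ereal_inf [set (f x)%:E | x in X].

(* Minimizing [g] over [Y] solves the problem of minimizing [f] over [X], the
   decision being read off through [pi]. *)
Definition solvable_as (R : realType) (T U : Type) (X : set T) (f : T -> R)
    (Y : set U) (g : U -> R) (pi : U -> T) : Prop :=
  [/\ optimal_value X f = optimal_value Y g,
      forall y, is_minimizer Y g y -> is_minimizer X f (pi y)
    & (exists x, is_minimizer X f x) -> exists y, is_minimizer Y g y].

(* Exact reformulation: [f x] is moreover the minimum of [g] over the feasible
   points with decision [x], for every [x] in [X], and all minimizers match. *)
Definition reformulation (R : realType) (T U : Type) (X : set T) (f : T -> R)
    (Y : set U) (g : U -> R) (pi : U -> T) : Prop :=
  [/\ solvable_as X f Y g pi,
      forall y, Y y -> X (pi y),
      forall x, X x ->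
        is_minimizer (Y `&` [set y | pi y = x]) g `&` [set y | g y = f x] !=set0
    & forall x, is_minimizer X f x <->
        exists y, is_minimizer Y g y /\ pi y = x].

(* Variables (x, nu, rho, t, z), the first four being the continuous ones. *)
Notation program_vars R d n m :=
  ('cV[R]_d * 'cV[R]_n * R^o * R^o * 'M[R]_(n, m))%type (only parsing).

Definition program_decision (R : realType) (d n m : nat)
    (y : program_vars R d n m) : 'cV[R]_d :=
  let: (x, nu, rho, t, z) := y in x.

Definition program_objective (R : realType) (d n m : nat) (w : 'I_n -> R)
    (lambda : R) (y : program_vars R d n m) : R :=
  let: (x, nu, rho, t, z) := y in
  \sum_(i < n) w i * nu i 0 + lambda * rho.

Definition program_feasible (R : realType) (d q m n : nat)
    (a : 'I_m -> 'cV[R]_d -> 'cV[R]_q) (b : 'I_m -> R) (w : 'I_n -> R)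
    (xi : 'I_n -> 'cV[R]_q) (X : set 'cV[R]_d) (M : R) :
    set (program_vars R d n m) :=
  [set y : program_vars R d n m | let: (x, nu, rho, t, z) := y in
    [/\ SOC n (col_mx (\col_(i < n) (Num.sqrt (w i) * (nu i 0 - t))) rho%:M),
        forall i j, piece a b x (xi i) j <= nu i 0,
        forall i j, nu i 0 <= piece a b x (xi i) j + M * (1 - z i j),
        forall i, \sum_(j < m) z i j = 1
      & X x /\ binary_mx z]].

(* The big-M constant dominates every gap between the loss and one of its
   pieces at a feasible decision and a data point. *)
Definition sufficiently_large (R : realType) (d q m n : nat) (m_gt0 : (0 < m)%N)
    (a : 'I_m -> 'cV[R]_d -> 'cV[R]_q) (b : 'I_m -> R) (xi : 'I_n -> 'cV[R]_q)
    (X : set 'cV[R]_d) (M : R) : Prop :=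
  forall x, X x -> forall i j,
    loss m_gt0 a b x (xi i) - piece a b x (xi i) j <= M.

(* Main.v *)
(** In a feasible point exactly one z_ij equals 1 for each i; then nu_i is at most
    the j-th piece and at least every piece, so nu_i is the loss at xi^i, whatever
    M is. The weights are nonnegative with sum 1, so the weighted mean minimizes
    t |-> sum_i w_i (nu_i - t)^2 and the cone constraint forces rho to dominate the
    standard deviation. Conversely, the loss values with the indicator of a
    maximizing piece are feasible as soon as M bounds the gaps between the loss
    and its pieces. *)
Require Import Defs.
From HB Require Import structures.
From mathcomp Require Import all_boot all_order all_algebra.
From mathcomp Require Import all_classical all_reals all_analysis.
From mathcomp Require Import ring.

Import Order.TTheory GRing.Theory Num.Theory.
Import numFieldNormedType.Exports.

Local Open Scope classical_set_scope.
Local Open Scope ring_scope.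

(** * Closure properties of affine maps *)

Section AffineMaps.
Context {R : realType}.
Implicit Types U V W : lmodType R.

Lemma linear_affine_map {V W} (f : V -> W) : linear f -> affine_map f.
Proof.
move=> f_lin.
pose L : {linear V -> W} := HB.pack f (GRing.isLinear.Build _ _ _ _ f f_lin).
by exists L, 0 => v; rewrite addr0.
Qed.

Lemma affine_map_cst {V W} (c : W) : affine_map (fun _ : V => c).
Proof. by exists \0, c => v; rewrite /= add0r. Qed.

Lemma affine_mapD {V W} (f g : V -> W) :
  affine_map f -> affine_map g -> affine_map (fun v => f v + g v).
Proof.
move=> [L [c fE]] [K [e gE]].
by exists (L \+ K), (c + e) => v; rewrite fE gE /= addrACA.
Qed.

Lemma affine_mapZ {V W} (k : R) (f : V -> W) :
  affine_map f -> affine_map (fun v => k *: f v).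
Proof.
move=> [L [c fE]].
by exists (k \*: L), (k *: c) => v; rewrite fE /= scalerDr.
Qed.

Lemma affine_mapN {V W} (f : V -> W) :
  affine_map f -> affine_map (fun v => - f v).
Proof.
move=> /(affine_mapZ (-1)) [L [c fE]].
by exists L, c => v; rewrite -fE scaleN1r.
Qed.

Lemma affine_mapB {V W} (f g : V -> W) :
  affine_map f -> affine_map g -> affine_map (fun v => f v - g v).
Proof. by move=> f_aff /affine_mapN; apply: affine_mapD. Qed.

Lemma affine_map_comp {U V W} (f : V -> W) (g : U -> V) :
  affine_map f -> affine_map g -> affine_map (fun u => f (g u)).
Proof.
move=> [L [c fE]] [K [e gE]].
by exists (L \o K), (L e + c) => v; rewrite fE gE linearD /= addrA.
Qed.

Lemma affine_map_entry m n (i : 'I_m) (j : 'I_n) :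
  affine_map (fun A : 'M[R]_(m, n) => A i j : R^o).
Proof. by apply: linear_affine_map => k A B; rewrite !mxE. Qed.

Lemma affine_map_pair {V W W'} (f : V -> W) (g : V -> W') :
  affine_map f -> affine_map g -> affine_map (fun v => (f v, g v)).
Proof.
move=> [L [c fE]] [K [e gE]].
have lin : linear (fun v => (L v, K v)) by move=> k u v; rewrite !linearP.
(* Packing the pairing of [L] and [K] as a linear map yields some offset [z], not visibly 0, so it
   is carried into the constant. *)
have [P [z PE]] := linear_affine_map _ lin.
exists P, (z + (c, e)) => v; rewrite addrA -PE fE gE.
by [].
Qed.

End AffineMaps.

(** * Calculus of second-order cone representable sets *)

Section SOCRepresentable.
Context {R : realType}.
Implicit Types V W : lmodType R.

(** Enumerating [I] allows constraints indexed by sums and pairs of ordinals. *)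
Lemma SOC_representable_fin {V} (I : finType) k (s : I -> nat)
    (f : forall l : I, (V * 'cV[R]_k)%type -> 'cV[R]_(s l + 1)) :
  (forall l, affine_map (f l)) ->
  SOC_representable
    [set v | exists u : 'cV[R]_k, forall l, SOC (s l) (f l (v, u))].
Proof.
move=> f_aff; exists k, #|I|, (s \o enum_val), (fun l => f (enum_val l)).
split=> [l|]; first exact: f_aff.
apply/seteqP; split=> v [u fu]; exists u => l; first exact: fu.
by have := fu (enum_rank l); rewrite /= enum_rankK.
Qed.

(** The auxiliary vectors are stacked and the constraints indexed by a disjoint union, so neither
    system sees the other's variables. *)
Lemma SOC_representableI {V} (A B : set V) :
  SOC_representable A -> SOC_representable B -> SOC_representable (A `&` B).
Proof.
move=> [k [N [s [f [f_aff ->]]]]] [k' [N' [s' [f' [f'_aff ->]]]]].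
pose t (l : 'I_N + 'I_N') := match l with inl l => s l | inr l => s' l end.
pose g (l : 'I_N + 'I_N') : (V * 'cV[R]_(k + k'))%type -> 'cV[R]_(t l + 1) :=
  match l return (V * 'cV[R]_(k + k'))%type -> 'cV[R]_(t l + 1) with
  | inl l => fun y => f l (y.1, usubmx y.2)
  | inr l => fun y => f' l (y.1, dsubmx y.2)
  end.
have g_aff l : affine_map (g l).
  case: l => l; [apply: affine_map_comp _ _ (f_aff l) _|
                 apply: affine_map_comp _ _ (f'_aff l) _];
  apply: affine_map_pair; apply: linear_affine_map => c u v //=;
  by rewrite !linearP.
rewrite (_ : _ `&` _ = [set v | exists u, forall l, SOC (t l) (g l (v, u))]).
  exact: SOC_representable_fin.
apply/seteqP; split=> v.
- move=> [[u fu] [u' fu']]; exists (col_mx u u') => -[l|l] /=.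
    by rewrite col_mxKu; apply: fu.
  by rewrite col_mxKd; apply: fu'.
- move=> [u gu]; split.
    by exists (usubmx u) => l; apply: (gu (inl l)).
  by exists (dsubmx u) => l; apply: (gu (inr l)).
Qed.

Lemma SOC_representable_preimage {V W} (f : V -> W) (A : set W) :
  affine_map f -> SOC_representable A -> SOC_representable (f @^-1` A).
Proof.
move=> f_aff [k [N [s [g [g_aff ->]]]]].
exists k, N, s, (fun l y => g l (f y.1, y.2)); split=> // l.
apply: affine_map_comp _ _ (g_aff l) _; apply: affine_map_pair.
  by apply: affine_map_comp _ _ f_aff _; apply: linear_affine_map.
exact: linear_affine_map.
Qed.

Lemma SOC_representable_SOC k : SOC_representable (@SOC R k).
Proof.
exists 0, 1, (fun=> k), (fun _ y => y.1); split.
  by move=> l; apply: linear_affine_map.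
apply/seteqP; split=> [v Av|v [u /(_ ord0)]//].
by exists 0 => l.
Qed.

Lemma SOC_col_mx k (u : 'cV[R]_k) (r : R) :
  SOC k (col_mx u r%:M) <-> l2norm u <= r.
Proof. by rewrite /SOC /= col_mxKu col_mxKd mxE eqxx. Qed.

(** An affine inequality is a cone constraint with empty vector part, whose norm is 0. *)
Lemma SOC_representable_ge0 {V} (I : finType) (f : I -> V -> R^o) :
  (forall i, affine_map (f i)) ->
  SOC_representable [set v | forall i, 0 <= f i v].
Proof.
move=> f_aff.
rewrite (_ : mkset _ = [set v | exists u : 'cV[R]_0, forall i,
    SOC 0 (col_mx 0 ((f i (v, u).1)%:M : 'cV[R]_1))]).
  apply: (SOC_representable_fin (V := V) _ 0 (fun=> 0%N)
    (fun i y => col_mx 0 ((f i y.1)%:M : 'cV[R]_1))) => i.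
  have cone_aff : affine_map (fun r : R^o => col_mx 0 (r%:M : 'cV[R]_1) : 'cV[R]_(0 + 1)).
    apply: linear_affine_map => k u v.
    rewrite scale_col_mx add_col_mx scaler0 addr0.
    by rewrite raddfD /= scale_scalar_mx.
  have fst_aff : affine_map (fun y : V * 'cV[R]_0 => y.1) by exact: linear_affine_map.
  exact: affine_map_comp _ _ cone_aff (affine_map_comp _ _ (f_aff i) fst_aff).
apply/seteqP; split=> v /=.
  by move=> fv; exists 0 => i; apply/SOC_col_mx; rewrite /l2norm big_ord0 sqrtr0.
move=> [u fv] i; have /SOC_col_mx := fv i.
by rewrite /l2norm big_ord0 sqrtr0.
Qed.

End SOCRepresentable.

(** * Transfer of optima between a problem and a relaxation that projects onto it *)

Section Reformulation.
Context {R : realType} {T U : Type}.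
Context {X : set T} {f : T -> R} {Y : set U} {g : U -> R} {dec : U -> T}.
Hypothesis relax : forall y, Y y -> X (dec y) /\ f (dec y) <= g y.

Lemma minimizer_lift x y :
  is_minimizer X f x -> Y y -> g y = f x -> is_minimizer Y g y.
Proof.
move=> [_ x_min] Yy gy; split=> // y' /relax[Xy' fgy'].
by rewrite gy (le_trans (x_min _ Xy')).
Qed.

Lemma minimizer_project x y y' :
  is_minimizer X f x -> Y y -> g y = f x ->
  is_minimizer Y g y' -> is_minimizer X f (dec y').
Proof.
move=> [_ x_min] Yy gy [Yy' y'_min]; have [Xy' fgy'] := relax _ Yy'.
split=> // x' /x_min; apply: le_trans; rewrite -gy.
exact: le_trans fgy' (y'_min _ Yy).
Qed.

Lemma optimal_value_le : (optimal_value X f <= optimal_value Y g)%E.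
Proof.
apply: le_ereal_inf_tmp => _ [y Yy <-]; have [Xy fgy] := relax _ Yy.
by apply: ge_ereal_inf; exists (f (dec y))%:E; [exists (dec y) | rewrite lee_fin].
Qed.

(** One minimizer lifted at equal cost suffices: by [relax] its lift is optimal, so the two optimal
    values agree. *)
Lemma solvable_as_minimizer x y :
  is_minimizer X f x -> Y y -> g y = f x -> solvable_as X f Y g dec.
Proof.
move=> x_min Yy gy; split.
- apply/eqP; rewrite eq_le optimal_value_le /=.
  apply: le_ereal_inf_tmp => _ [x' Xx' <-].
  apply: ge_ereal_inf; exists (g y)%:E; first by exists y.
  by rewrite lee_fin gy; apply: x_min.2.
- by move=> y'; apply: minimizer_project _ _ _ x_min Yy gy.
- by move=> _; exists y; apply: minimizer_lift _ _ x_min Yy gy.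
Qed.

(** With lifts over all of [X] the infima agree even when they are not attained. *)
Lemma reformulation_lift :
  (forall x, X x -> exists y, [/\ Y y, dec y = x & g y = f x]) ->
  reformulation X f Y g dec.
Proof.
move=> lift.
have project y : is_minimizer Y g y -> is_minimizer X f (dec y).
  move=> [Yy y_min]; have [Xy fgy] := relax _ Yy.
  split=> // x /lift[y' [Yy' _ <-]].
  exact: le_trans fgy (y_min _ Yy').
split.
- split=> //.
    apply/eqP; rewrite eq_le optimal_value_le /=.
    apply: le_ereal_inf_tmp => _ [x /lift[y [Yy _ <-]] <-].
    by apply: ge_ereal_inf; exists (g y)%:E => //; exists y.
  move=> [x x_min]; have [y [Yy _ gy]] := lift _ x_min.1.
  by exists y; apply: minimizer_lift _ _ x_min Yy gy.
- by move=> y /relax[].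
- move=> x /lift[y [Yy decy gy]]; exists y; split=> //; split=> // y' [Yy' decy'].
  by rewrite gy -decy'; have [] := relax _ Yy'.
- move=> x; split=> [x_min|[y [/project y_min <-]]//].
  have [y [Yy decy gy]] := lift _ x_min.1.
  by exists y; split=> //; apply: minimizer_lift _ _ x_min Yy gy.
Qed.

End Reformulation.

(** * Weighted means and kernel weights *)

Lemma weighted_mean_minimizes {R : realType} {n} (w y : 'I_n -> R) t :
  \sum_i w i = 1 \/ (forall i, w i = 0) ->
  \sum_i w i * (y i - \sum_j w j * y j) ^+ 2 <= \sum_i w i * (y i - t) ^+ 2.
Proof.
case=> [w1|w0]; last by rewrite !big1 // => i _; rewrite w0 mul0r.
set e := \sum_j w j * y j; rewrite -subr_ge0 -sumrB.
(* With total weight 1, the second moments about [t] and about the mean [e] differ by exactly this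
   square. *)
rewrite (_ : \sum_i _ = (e - t) ^+ 2) ?sqr_ge0 //.
transitivity ((e - t) * \sum_i (2 * (w i * y i) - (t + e) * w i)).
  by rewrite mulr_sumr; apply: eq_bigr => i _; ring.
by rewrite sumrB -!mulr_sumr w1 -/e; ring.
Qed.

(* The normalizing constant of the kernel cancels in the weights. If it had the
   junk value 0, every weight would vanish; the program stays exact in this
   degenerate case as well, so the constant need not be computed. *)
Lemma kernel_weight_cases {R : realType} {p n} (gam : 'I_n -> 'cV[R]_p) gamma h :
  let w := kernel_weight gam gamma h in
  (forall i, 0 <= w i) /\ (\sum_i w i = 1 \/ forall i, w i = 0).
Proof.
set e := fun i => expR (- l2norm (h^-1 *: (gamma - gam i))).
set Z := kernel_Z R p => w.
have wE i : w i = (Z^-1 * Z) * (e i / \sum_j e j).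
  by rewrite /w /kernel_weight /exp_kernel -/Z -mulr_sumr invfM invrK -/(e i); ring.
have [Z0|Z_neq0] := eqVneq Z 0.
  have w0 i : w i = 0 by rewrite wE Z0 mulr0 mul0r.
  by split=> [i|]; [rewrite w0 | right].
have {}wE i : w i = e i / \sum_j e j by rewrite wE mulVf // mul1r.
split=> [i|].
  by rewrite wE divr_ge0 ?expR_ge0 // sumr_ge0 // => j _; apply: expR_ge0.
(* Exponentials are positive, so this sum vanishes only for [n = 0]. *)
have [e0|e_neq0] := eqVneq (\sum_j e j) 0.
  by right=> i; rewrite wE e0 invr0 mulr0.
left; rewrite (eq_bigr _ (fun i _ => wE i)) -mulr_suml divff //.
Qed.

(** * The mixed-integer program and its exactness *)

Section Program.
Context {R : realType} {d q m n : nat} (m_gt0 : (0 < m)%N).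
Context {a : 'I_m -> 'cV[R]_d -> 'cV[R]_q} {b : 'I_m -> R}.
Context {xi : 'I_n -> 'cV[R]_q} {X : set 'cV[R]_d} {w : 'I_n -> R} {lambda : R}.

Local Notation piece := (piece a b).
Local Notation loss := (loss m_gt0 a b).
Local Notation feasible := (program_feasible a b w xi X).
Local Notation cost := (@program_objective R d n m w lambda).
Local Notation decision := (@program_decision R d n m).
Local Notation f := (regularized_objective m_gt0 a b w xi lambda).

Lemma piece_le_loss x v j : piece x v j <= loss x v.
Proof. exact: le_bigmax. Qed.

(** The maximum starts at a piece, so no value foreign to the family can be returned. *)
Lemma loss_attained x v : exists j, loss x v = piece x v j.
Proof.
apply: (big_ind (fun r => exists j, r = piece x v j)); first by exists (Ordinal m_gt0).
  by move=> _ _ [j ->] [k ->]; case: leP; [exists k | exists j].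
by move=> j _; exists j.
Qed.

Lemma affine_map_piece (a_affine : forall j, affine_map (a j)) v j :
  affine_map (fun x => piece x v j : R^o).
Proof.
apply: affine_mapD; last exact: affine_map_cst.
apply: (affine_map_comp (fun u : 'cV[R]_q => dot u v : R^o)); last exact: a_affine.
apply: linear_affine_map => k u u'.
by rewrite /dot linearP mulmxDl -scalemxAl !mxE.
Qed.

Lemma l2norm_weighted (nu : 'cV[R]_n) t : (forall i, 0 <= w i) ->
  l2norm (\col_i (Num.sqrt (w i) * (nu i 0 - t))) =
  Num.sqrt (\sum_i w i * (nu i 0 - t) ^+ 2).
Proof.
move=> w_ge0; congr Num.sqrt; apply: eq_bigr => i _.
by rewrite mxE exprMn sqr_sqrtr.
Qed.

(** [M] and the roots of the weights are constants, so no constraint multiplies two variables. *)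
Lemma mixed_integer_SOCP_program M :
  (forall j, affine_map (a j)) -> SOC_representable X ->
  mixed_integer_SOCP (feasible M) cost.
Proof.
move=> a_affine X_SOC; split.
  apply: linear_affine_map => k [[[[x nu] rho] t] z] [[[[x' nu'] rho'] t'] z'] /=.
  have sumE : \sum_i w i * (k *: nu + nu') i 0 =
      k * (\sum_i w i * nu i 0) + \sum_i w i * nu' i 0.
    rewrite mulr_sumr -big_split; apply: eq_bigr => i _.
    by rewrite !mxE /=; ring.
  by rewrite sumE /GRing.scale /=; ring.
pose nu_ (y : program_vars R d n m) := let: (x, nu, rho, t, z) := y in nu.
pose z_ (y : program_vars R d n m) := let: (x, nu, rho, t, z) := y in z.
pose cone_ (y : program_vars R d n m) : 'cV[R]_(n + 1) :=
  let: (x, nu, rho, t, z) := y in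
  col_mx (\col_i (Num.sqrt (w i) * (nu i 0 - t))) (rho : R)%:M.
have x_aff : affine_map decision.
  by apply: linear_affine_map => k [[[[? ?] ?] ?] ?] [[[[? ?] ?] ?] ?].
have nu_aff i : affine_map (fun y => nu_ y i 0 : R^o).
  apply: (affine_map_comp (fun u : 'cV[R]_n => u i 0 : R^o)).
    exact: affine_map_entry.
  by apply: linear_affine_map => k [[[[? ?] ?] ?] ?] [[[[? ?] ?] ?] ?].
have z_aff i j : affine_map (fun y => z_ y i j : R^o).
  apply: (affine_map_comp (fun A : 'M[R]_(n, m) => A i j : R^o)).
    exact: affine_map_entry.
  by apply: linear_affine_map => k [[[[? ?] ?] ?] ?] [[[[? ?] ?] ?] ?].
have zsum_aff i : affine_map (fun y => \sum_j z_ y i j : R^o).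
  apply: linear_affine_map => k [[[[? ?] ?] ?] z] [[[[? ?] ?] ?] z'] /=.
  rewrite scaler_sumr -big_split /=.
  by apply: eq_bigr => j _; rewrite !mxE.
have piece_aff i j : affine_map (fun y => piece (decision y) (xi i) j : R^o).
  by apply: (affine_map_comp (fun x => piece x (xi i) j : R^o));
    [exact: affine_map_piece | exact: x_aff].
have cone_aff : affine_map cone_.
  apply: linear_affine_map => k [[[[? nu] rho] t] ?] [[[[? nu'] rho'] t'] ?] /=.
  rewrite scale_col_mx add_col_mx; congr col_mx.
    by apply/matrixP => i j; rewrite !mxE /GRing.scale /=; ring.
  by rewrite raddfD /= scale_scalar_mx.
(* Each row-sum equation becomes two opposite inequalities; only integrality of [z] stays outside
   this set. *)
exists (cone_ @^-1` SOC n `&`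
  [set y | forall ij, 0 <= nu_ y ij.1 0 - piece (decision y) (xi ij.1) ij.2] `&`
  [set y | forall ij, 0 <= piece (decision y) (xi ij.1) ij.2 +
                           M *: (1 - z_ y ij.1 ij.2) - nu_ y ij.1 0] `&`
  [set y | forall i, 0 <= \sum_j z_ y i j - 1] `&`
  [set y | forall i, 0 <= 1 - \sum_j z_ y i j] `&`
  decision @^-1` X).
split.
  do ![apply: SOC_representableI].
  - apply: SOC_representable_preimage => //; exact: SOC_representable_SOC.
  - by apply: SOC_representable_ge0 => ij; apply: affine_mapB.
  - apply: SOC_representable_ge0 => ij; apply: affine_mapB => //.
    apply: affine_mapD => //; apply: affine_mapZ; apply: affine_mapB => //.
    exact: affine_map_cst.
  - apply: SOC_representable_ge0 => i; apply: affine_mapB => //.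
    exact: affine_map_cst.
  - apply: SOC_representable_ge0 => i; apply: affine_mapB => //.
    exact: affine_map_cst.
  - exact: SOC_representable_preimage.
apply/seteqP; split=> -[[[[x nu] rho] t] z] /=.
  move=> [cone_y le_nu ge_nu z1 [Xx z_bin]].
  split=> //; split=> //; split; last by move=> i; rewrite z1 subrr.
  split; last by move=> i; rewrite z1 subrr.
  split; last by move=> [i j] /=; rewrite subr_ge0; apply: ge_nu.
  split=> // -[i j] /=; rewrite subr_ge0; exact: le_nu.
move=> [[[[[[cone_y le_nu] ge_nu] z1] z1'] Xx] z_bin]; split=> //.
- by move=> i j; have := le_nu (i, j); rewrite /= subr_ge0.
- by move=> i j; have := ge_nu (i, j); rewrite /= subr_ge0.
- move=> i; apply/eqP; rewrite eq_le -subr_ge0 z1' -subr_ge0; exact: z1.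
Qed.

Hypothesis w_ge0 : forall i, 0 <= w i.
Hypothesis w_cases : \sum_i w i = 1 \/ forall i, w i = 0.
Hypothesis lambda_ge0 : 0 <= lambda.

Lemma feasible_nu M x nu rho t z : feasible M (x, nu, rho, t, z) ->
  forall i, nu i 0 = loss x (xi i).
Proof.
move=> /= [_ le_nu ge_nu z1 [_ z_bin]] i; apply/eqP; rewrite eq_le.
apply/andP; split; last by have [j ->] := loss_attained x (xi i); apply: le_nu.
(* Otherwise the binary row [i] is zero and cannot sum to 1. *)
have [j zj] : exists j, z i j = 1.
  apply: contrapT => /forallNP z_neq1.
  have := z1 i; rewrite big1 => [|j _]; first by move/esym/eqP; rewrite oner_eq0.
  by case: (z_bin i j) => // /z_neq1.
apply: le_trans (ge_nu i j) _.
by rewrite zj subrr mulr0 addr0 piece_le_loss.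
Qed.

(** This half of the equivalence holds for every [M]; the size of [M] matters only for lifting
    decisions. *)
Lemma program_relaxes M y :
  feasible M y -> X (decision y) /\ f (decision y) <= cost y.
Proof.
case: y => [[[[x nu] rho] t] z] y_feas; have nuE := feasible_nu _ _ _ _ _ _ y_feas.
case: y_feas => /= [/SOC_col_mx cone_y _ _ _ [Xx _]]; split=> //.
rewrite /regularized_objective /NW_variance /NW_expectation.
under [in leRHS]eq_bigr do rewrite nuE.
rewrite lerD2l ler_wpM2l //; apply: le_trans cone_y.
rewrite l2norm_weighted //; under [in leRHS]eq_bigr do rewrite nuE.
by rewrite ler_wsqrtr // weighted_mean_minimizes.
Qed.

(** The gap bound is required at [x] only, so [M] may be chosen for a single decision. *)
Lemma program_attains (M : R) x : X x ->
  (forall i j, loss x (xi i) - piece x (xi i) j <= M) ->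
  exists y, [/\ feasible M y, decision y = x & cost y = f x].
Proof.
move=> Xx gap.
have [k kE] := choice (fun i => loss_attained x (xi i)).
pose nu : 'cV[R]_n := \col_i loss x (xi i).
pose z : 'M[R]_(n, m) := \matrix_(i, j) (j == k i)%:R.
pose var := NW_variance w xi (loss x).
(* Taking [t] as the mean and [rho] as the standard deviation makes the cone constraint tight. *)
exists (x, nu, Num.sqrt var, NW_expectation w xi (loss x), z); split=> //=; last first.
  by congr (_ + _); apply: eq_bigr => i _; rewrite mxE.
split.
- apply/SOC_col_mx; rewrite l2norm_weighted //.
  by under eq_bigr do rewrite mxE.
- by move=> i j; rewrite mxE piece_le_loss.
(* At the selected piece the big-M term vanishes and equality holds; elsewhere it equals [M] and
   covers the gap. *)
- move=> i j; rewrite !mxE; case: eqVneq => [->|_].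
    by rewrite subrr mulr0 addr0 kE.
  by rewrite subr0 mulr1 -lerBlDl.
- move=> i; rewrite (bigD1 (k i)) //= mxE eqxx big1 ?addr0 // => j /negbTE jk.
  by rewrite mxE jk.
- by split=> // i j; rewrite mxE; case: eqP => _; [right | left].
Qed.

Lemma reformulation_program M : sufficiently_large m_gt0 a b xi X M ->
  reformulation X f (feasible M) cost decision.
Proof.
move=> M_large; apply: reformulation_lift => [|x Xx].
  exact: program_relaxes.
by apply: program_attains => // i j; apply: M_large.
Qed.

Lemma solvable_as_program x (M : R) : is_minimizer X f x ->
  (forall i j, loss x (xi i) - piece x (xi i) j <= M) ->
  solvable_as X f (feasible M) cost decision.
Proof.
move=> x_min gap; have [y [y_feas _ gy]] := program_attains _ _ x_min.1 gap.
exact: solvable_as_minimizer (program_relaxes M) _ _ x_min y_feas gy.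
Qed.

End Program.

(** * Existence of big-M constants *)

Lemma affine_map_bounded {R : realType} {d} (f : 'cV[R]_d -> R^o) (X : set 'cV[R]_d) :
  affine_map f -> bounded_set X -> exists B, forall x, X x -> `|f x| <= B :> R.
Proof.
(* Boundedness controls the norm by each real strictly above [B], hence [B + 1]. Expanding [x] in
   the canonical basis then bounds [L x]. *)
move=> [L [c fE]] [B [_ /(_ (B + 1))]]; rewrite ltrDl ltr01 => /(_ isT) XB.
exists (\sum_i (B + 1) * `|L (delta_mx i 0)| + `|c|) => x /XB x_le.
rewrite fE (le_trans (ler_normD _ _)) // lerD2r.
rewrite [x in L x]matrix_sum_delta linear_sum (le_trans (ler_norm_sum _ _ _)) //.
apply: ler_sum => i _; rewrite big_ord1 linearZ /= normrM ler_wpM2r //.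
apply: le_trans x_le; rewrite /Num.norm /= mx_normrE.
exact: (le_bigmax _ (fun ij => `|x ij.1 ij.2|) (i, ord0)).
Qed.

Lemma finite_upper_bound {R : realType} {I : finType} (u : I -> R) :
  exists2 M : R, 0 < M & forall i, u i <= M.
Proof.
(* Starting the maximum at 1 keeps it positive, even over an empty type. *)
exists (\big[Num.max/1]_i u i) => [|i]; last exact: le_bigmax.
by rewrite (lt_le_trans ltr01) // bigmax_ge_id.
Qed.

Lemma bounded_sufficiently_large {R : realType} {d q m n : nat} (m_gt0 : (0 < m)%N)
    (a : 'I_m -> 'cV[R]_d -> 'cV[R]_q) (b : 'I_m -> R) (xi : 'I_n -> 'cV[R]_q)
    (X : set 'cV[R]_d) :
  (forall j, affine_map (a j)) -> bounded_set X ->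
  exists2 M : R, 0 < M & sufficiently_large m_gt0 a b xi X M.
Proof.
move=> a_affine X_bounded.
have /choice[B BP] (ij : 'I_n * 'I_m) :
    exists B, forall x, X x -> `|piece a b x (xi ij.1) ij.2| <= B.
  exact: affine_map_bounded _ _ (affine_map_piece a_affine _ _) X_bounded.
have [M M_gt0 MP] := finite_upper_bound B.
(* A gap is a difference of two pieces, each of absolute value at most [M]. *)
exists (M + M) => [|x Xx i j]; first by rewrite addr_gt0.
have [k ->] := loss_attained m_gt0 (a := a) (b := b) x (xi i).
have norm_le j' : `|piece a b x (xi i) j'| <= M.
  exact: le_trans (BP (i, j') x Xx) (MP _).
apply: lerD; first exact: le_trans (ler_norm _) (norm_le k).
by apply: le_trans (norm_le j); rewrite -normrN ler_norm.
Qed.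

(** On an unbounded [X] the gaps between affine pieces may be unbounded, hence the separate readings
    of a sufficiently large constant. *)
Theorem proposition4 (R : realType) (p q d n m : nat) (m_gt0 : (0 < m)%N)
    (gam : 'I_n -> 'cV[R]_p) (xi : 'I_n -> 'cV[R]_q)
    (gamma : 'cV[R]_p) (h : R) (h_gt0 : 0 < h) (lambda : R) (lambda_ge0 : 0 <= lambda)
    (a : 'I_m -> 'cV[R]_d -> 'cV[R]_q) (b : 'I_m -> R)
    (a_affine : forall j, affine_map (a j))
    (X : set 'cV[R]_d) (X_SOC : SOC_representable X) :
  let w := kernel_weight gam gamma h in
  let l := loss m_gt0 a b in
  let f := regularized_objective m_gt0 a b w xi lambda in
  let F := fun M : R => program_feasible a b w xi X M in
  let g := @program_objective R d n m w lambda in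
  let dec := @program_decision R d n m in
  [/\
      (* the program is a mixed-integer second-order cone program *)
      forall M : R, mixed_integer_SOCP (F M) g,
      (* a sufficiently large constant, relative to an attained minimum *)
      (exists x, is_minimizer X f x) ->
        exists M0 : R, 0 < M0 /\
          forall M, M0 <= M -> solvable_as X f (F M) g dec,
      (* a constant that is sufficiently large uniformly on X *)
      forall M : R, 0 < M -> sufficiently_large m_gt0 a b xi X M ->
        reformulation X f (F M) g dec,
      (* such constants exist when X is bounded *)
      bounded_set X ->
        exists M0 : R, 0 < M0 /\
          forall M, M0 <= M -> reformulation X f (F M) g dec
      (* M = 1 *)
    & (forall x, X x -> forall i, 0 <= l x (xi i) <= 1) ->
      (forall x, X x -> forall i j, 0 <= piece a b x (xi i) j) ->
        reformulation X f (F 1) g dec].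

Proof.
move=> w l f F g dec.
have [w_ge0 w_cases] := kernel_weight_cases gam gamma h.
split.
- by move=> M; apply: mixed_integer_SOCP_program.
- move=> [x x_min].
  (* At the fixed minimizer [x] there are only finitely many gaps. *)
  have [M0 M0_gt0 M0P] := finite_upper_bound
    (fun ij : 'I_n * 'I_m => l x (xi ij.1) - piece a b x (xi ij.1) ij.2).
  exists M0; split=> // M le_M; apply: solvable_as_program _ _ _ _ _ _ x_min _ => // i j.
  exact: le_trans (M0P (i, j)) le_M.
- by move=> M _; apply: reformulation_program.
- move=> /(bounded_sufficiently_large m_gt0 _ b xi _ a_affine)[M0 M0_gt0 M0P].
  exists M0; split=> // M le_M; apply: reformulation_program => // x Xx i j.
  exact: le_trans (M0P x Xx i j) le_M.
- move=> l01 piece_ge0; apply: reformulation_program => // x Xx i j.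
  have /andP[_ l1] := l01 x Xx i.
  (* A loss in [0,1] alone leaves non-maximal pieces unbounded below; nonnegative pieces bring every
     gap down to at most 1. *)
  by rewrite lerBlDr (le_trans l1) // lerDl piece_ge0.
Qed.
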